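(* Let $M$ be a matroid with no isthmuses (coloops), having $n$ elements and rank $r$. If $r \geq 4$ and \[ n \geq \left\lceil r(\log_2 r + \log_2\log_2 r + \log_2\log_2\log_2 r) \right\rceil, \] then $T(M;0,2) \geq 2\,T(M;1,1)$. In particular, \[ T(M;2,0) + T(M;0,2) \geq 2\,T(M;1,1). \]
   Context: For a matroid $M$ on ground set $E$ with rank function $\rho$, the Tutte polynomial is $T(M;x,y) = \sum_{A \subseteq E} (x-1)^{\rho(E)-\rho(A)} (y-1)^{|A|-\rho(A)}$. An isthmus (coloop) is an element contained in every basis. All logarithms are in base $2$. *)

(* Defs.v *)
From HB Require Import structures.
From mathcomp Require Import all_boot all_order all_algebra.
From mathcomp Require Import reals exp.
Set Implicit Arguments.
Unset Strict Implicit.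
Unset Printing Implicit Defensive.
Import Order.TTheory GRing.Theory Num.Theory.
Local Open Scope ring_scope.

(* The ground set is the whole finite type E, so subsets of it are {set E}. *)
Record matroid (E : finType) := Matroid {
  indep : {set {set E}};
  indep_set0 : set0 \in indep;
  indep_subset : forall A B : {set E},
    A \subset B -> B \in indep -> A \in indep;
  indep_augment : forall A B : {set E},
    A \in indep -> B \in indep -> (#|A| < #|B|)%N ->
    exists2 x, x \in B :\: A & x |: A \in indep
}.

Definition basis (E : finType) (M : matroid E) (B : {set E}) : bool :=
  maxset [in indep M] B.

Definition rank (E : finType) (M : matroid E) (A : {set E}) : nat :=
  \max_(I in indep M | I \subset A) #|I|.

Definition isthmus (E : finType) (M : matroid E) (e : E) : Prop :=
  forall B : {set E}, basis M B -> e \in B.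

Lemma rank_subset (E : finType) (M : matroid E) (A B : {set E}) :
  A \subset B -> (rank M A <= rank M B)%N.
Proof.
move=> sAB; apply/bigmax_leqP => I /andP[iI sIA].
by apply: leq_bigmax_cond; rewrite iI (subset_trans sIA sAB).
Qed.

Lemma rank_card (E : finType) (M : matroid E) (A : {set E}) :
  (rank M A <= #|A|)%N.
Proof. by apply/bigmax_leqP => I /andP[_ sIA]; apply: subset_leq_card. Qed.

(* By rank_subset and rank_card the truncated subtractions in the exponents   *)
(* are exact.  Note that 0 ^+ 0 = 1, as the formula requires when x or y is 1. *)
Definition tutte (R : comNzRingType) (E : finType) (M : matroid E) (x y : R) : R :=
  \sum_(A : {set E})
    (x - 1) ^+ (rank M [set: E] - rank M A) * (y - 1) ^+ (#|A| - rank M A).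

(* Junk values of ln on nonpositive reals are not reached in iterating log2   *)
(* three times from r >= 4: log2 r >= 2 and log2 (log2 r) >= 1.               *)
Definition log2 (R : realType) (x : R) : R := ln x / ln 2.

(* Main.v *)
(* Write b = T(M;1,1), and let M have rank r on n elements.  Without isthmuses,   *)
(* T(M;0,2) >= 2^(n-r), since contraction creates no isthmus, while b <= C(n,r).  *)
(* For r >= 8 the hypothesis gives n >= 5r, and then 2^(n-r) >= 2 C(n,r).         *)
(* For 4 <= r <= 7 it gives n >= 3r, and the two bounds are too far apart.  There *)
(* deletion-contraction is applied to the affine inequality                       *)
(* T(M;0,2) >= 2b + slack(n,r).  It goes through as long as some nonloop can be   *)
(* deleted without creating an isthmus; otherwise M has at most 2r nonloops, so   *)
(* that b <= C(min(n,2r),r), and the bound 2^(n-r) suffices.  The recursion so    *)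
(* obtained for slack is nonnegative when n >= 3r and r <= 7 (not for all r).     *)

Require Import Defs.
From HB Require Import structures.
From mathcomp Require Import all_boot all_order all_algebra.
From mathcomp Require Import zify lra.
From mathcomp Require Import reals exp.
Set Implicit Arguments.
Unset Strict Implicit.
Unset Printing Implicit Defensive.
Import Order.TTheory GRing.Theory Num.Theory.
Local Open Scope ring_scope.

(** Everything is proved for minors, by the rank-only recursion [tutte_minorU1], because contraction
    keeps a matroid free of isthmuses while deletion may not. At (1,1) the polynomial counts bases,
    so it is at most a binomial coefficient in the number of nonloops ([tutte_minor_1_1_bounds]). At
    (0,2) it vanishes as soon as an isthmus appears ([tutte_minor_0_2_isthmus]), so a bad deletion
    costs nothing, and contractions alone give the power of 2 in [tutte_minor_0_2_ge].

    In large rank, [double_bin_le] compares these two bounds. In small rank,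
    [tutte_minor_0_2_affine] carries a correction term through the recursion, with
    [card_nonloops_le] for the minors where it stops and [slack_ge0] for the sign of the correction.
    The second claim follows from the first because T(M;2,0) is nonnegative
    ([tutte_minor_2_0_ge0]). *)

(** * Matroid rank: extension, closure and relative bases *)

Section Rank.
Variables (E : finType) (M : matroid E).
Implicit Types (A B C I J S : {set E}) (e x : E).
Local Notation rk := (rank M).

Lemma rank_indep I A : I \in indep M -> I \subset A -> (#|I| <= rk A)%N.
Proof.
by move=> iI sIA; apply: (@leq_bigmax_cond _ _ (fun J : {set E} => #|J|)); rewrite iI.
Qed.

Lemma rank_attained A : exists I, [/\ I \in indep M, I \subset A & #|I| = rk A].
Proof.
have [|I /andP[iI sIA] cI] := @eq_bigmax_cond _
  [pred I | (I \in indep M) && (I \subset A)] (fun J : {set E} => #|J|).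
  by apply/card_gt0P; exists set0; rewrite inE indep_set0 sub0set.
by exists I; split.
Qed.

Lemma indep_extend I A : I \in indep M -> I \subset A ->
  exists J, [/\ J \in indep M, I \subset J, J \subset A & #|J| = rk A].
Proof.
have [k] := ubnP (rk A - #|I|)%N; elim: k I => // k IHk I ltk iI sIA.
have le := rank_indep iI sIA.
have [eq_c|ne_c] := eqVneq #|I| (rk A); first by exists I; split.
have [K [iK sKA cK]] := rank_attained A.
have ltIK : (#|I| < #|K|)%N by rewrite cK ltn_neqAle ne_c.
have [x /setDP[xK xNI] iJ] := indep_augment iI iK ltIK.
have sJA : x |: I \subset A by rewrite subUset sub1set (subsetP sKA).
have [|J [iJ' sIJ sJA' cJ]] := IHk _ _ iJ sJA.
  by rewrite cardsU1 xNI; lia.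
by exists J; split=> //; apply: subset_trans sIJ; apply: subsetUr.
Qed.

Lemma rank_set0 : rk set0 = 0%N.
Proof. by apply/eqP; rewrite -leqn0 -(cards0 E) rank_card. Qed.

Lemma rankU1_le e A : (rk (e |: A) <= (rk A).+1)%N.
Proof.
have [I [iI sI <-]] := rank_attained (e |: A).
have sIeA : I :\ e \subset A by rewrite subDset.
have := rank_indep (indep_subset (subsetDl I [set e]) iI) sIeA.
by rewrite [#|I|](cardsD1 e); lia.
Qed.

(** Monotonicity of closure. If [e] raised the rank of [B], augmenting a basis of [B] that extends a
    basis of [A] could only add [e], and [e] would then raise the rank of [A] too. *)
Lemma rankU1_eq e A B : A \subset B -> rk (e |: A) = rk A -> rk (e |: B) = rk B.
Proof.
move=> sAB eqA; apply/eqP; rewrite eqn_leq (rank_subset M (subsetUr _ _)) andbT.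
have [I [iI sIA cI]] := rank_attained A.
have [J [iJ sIJ sJB cJ]] := indep_extend iI (subset_trans sIA sAB).
rewrite leqNgt; apply/negP => ltB.
have [K [iK sK cK]] := rank_attained (e |: B).
have ltJK : (#|J| < #|K|)%N by rewrite cJ cK.
have [x /setDP[xK xNJ] ixJ] := indep_augment iJ iK ltJK.
have [xB|xNB] := boolP (x \in B).
  have sxJB : x |: J \subset B by rewrite subUset sub1set xB.
  by have := rank_indep ixJ sxJB; rewrite cardsU1 xNJ cJ ltnn.
have xe : x = e by have := subsetP sK _ xK; rewrite in_setU1 (negPf xNB) orbF => /eqP.
have ieI : e |: I \in indep M by apply: indep_subset ixJ; rewrite xe setUS.
have := rank_indep ieI (setUS [set e] sIA).
by rewrite cardsU1 eqA -cI -xe (contra (subsetP sIJ x)) ?ltnn.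
Qed.

Lemma rankU_le A B : (rk (A :|: B) <= rk A + #|B|)%N.
Proof.
have [k] := ubnP #|B|; elim: k B => // k IHk B ltk.
have [->|[e eB]] := set_0Vmem B; first by rewrite setU0 cards0 addn0.
have := IHk (B :\ e); rewrite [#|B|](cardsD1 e) eB in ltk *.
have -> : A :|: B = e |: (A :|: (B :\ e)) by rewrite setUCA setD1K.
by have := rankU1_le e (A :|: (B :\ e)); lia.
Qed.

(** [B] is a basis of the minor (M / C) | S. *)
Lemma rel_basis C S :
  exists2 B : {set E}, B \subset S &
    rk (C :|: B) = rk (C :|: S) /\ #|B| = (rk (C :|: S) - rk C)%N.
Proof.
have [k] := ubnP #|S|; elim: k S => // k IHk S ltk.
have [->|[e eS]] := set_0Vmem S.
  by exists set0; rewrite ?sub0set // setU0 cards0 subnn.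
rewrite [#|S|](cardsD1 e) eS in ltk.
have [//|B sB [rB cB]] := IHk (S :\ e).
have sBS := subset_trans sB (subsetDl S [set e]).
have eqS : C :|: S = e |: (C :|: (S :\ e)) by rewrite setUCA setD1K.
have leS := rankU1_le e (C :|: (S :\ e)).
have geS := rank_subset M (subsetUr [set e] (C :|: (S :\ e))).
have [eqr|ner] := eqVneq (rk (e |: (C :|: (S :\ e)))) (rk (C :|: (S :\ e))).
  by exists B; rewrite // eqS eqr.
have leB := rankU1_le e (C :|: B).
have geB := rank_subset M (subsetUr [set e] (C :|: B)).
have neB : rk (e |: (C :|: B)) != rk (C :|: B).
  by apply: contra_neq ner; apply: rankU1_eq; apply: setUS.
have geC := rank_subset M (subsetUl C B).
exists (e |: B); first by rewrite subUset sub1set eS.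
rewrite setUCA cardsU1 eqS; have -> : e \notin B.
  by apply: contraTN eS => /(subsetP sB); rewrite !inE eqxx.
lia.
Qed.

End Rank.

(** * Tutte polynomials of minors and deletion-contraction *)

(* The Tutte polynomial of the minor (M / C) | S; an element of S that also lies  *)
(* in C behaves as a loop.                                                        *)
Definition tutte_minor (R : comNzRingType) (E : finType) (M : matroid E)
    (C S : {set E}) (x y : R) : R :=
  \sum_(A : {set E} | A \subset S)
    (x - 1) ^+ (rank M (C :|: S) - rank M (C :|: A))
    * (y - 1) ^+ (#|A| - (rank M (C :|: A) - rank M C)).

Definition coloopless (E : finType) (M : matroid E) (C S : {set E}) : bool :=
  [forall e in S, rank M (C :|: (S :\ e)) == rank M (C :|: S)].

Definition nonloops (E : finType) (M : matroid E) (C S : {set E}) : {set E} :=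
  [set e in S | rank M (e |: C) != rank M C].

Lemma big_subsetU1 (R : nmodType) (E : finType) (e : E) (S : {set E})
    (F : {set E} -> R) : e \notin S ->
  \sum_(A : {set E} | A \subset e |: S) F A =
  \sum_(A : {set E} | A \subset S) F A + \sum_(A : {set E} | A \subset S) F (e |: A).
Proof.
move=> eNS; rewrite (bigID (fun A : {set E} => e \in A)) /= addrC; congr (_ + _).
  apply: eq_bigl => A; apply/andP/idP => [[sA eNA]|sA].
    by apply/subsetP => x xA; have := subsetP sA x xA; rewrite !inE;
      case: eqP => // xe; rewrite -xe xA in eNA.
  split; first exact: subset_trans sA (subsetUr _ _).
  by apply: contra eNS; apply: subsetP.
rewrite (reindex_onto (fun A => e |: A) (fun A => A :\ e)) /=; last first.
  by move=> A /andP[_ eA]; rewrite setD1K.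
apply: eq_bigl => A; rewrite setU11 andbT; apply/andP/idP => [[sA /eqP<-]|sA].
  by rewrite subDset (subset_trans _ sA).
have eNA : e \notin A by apply: contra eNS; apply: subsetP.
by rewrite setUS // setU1K.
Qed.

Lemma minor_ind (E : finType) (P : {set E} -> {set E} -> Prop) :
  (forall C, P C set0) ->
  (forall (C S : {set E}) (e : E), e \notin S -> P C S -> P (e |: C) S -> P C (e |: S)) ->
  forall C S, P C S.
Proof.
move=> P0 PU C S; have [k] := ubnP #|S|; elim: k C S => // k IHk C S ltk.
have [->|[e eS]] := set_0Vmem S; first exact: P0.
rewrite [#|S|](cardsD1 e) eS in ltk; rewrite -(setD1K eS).
by apply: PU; rewrite ?setD11 //; apply: IHk.
Qed.

Section DeletionContraction.
Variables (E : finType) (M : matroid E).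
Implicit Types (A B C S : {set E}) (e x : E).
Local Notation rk := (rank M).

Lemma tutte_minor_set0 (R : comNzRingType) C (x y : R) : tutte_minor M C set0 x y = 1.
Proof.
rewrite /tutte_minor (big_pred1 set0) => [|A]; last by rewrite subset0.
by rewrite subnn cards0 expr0 mulr1.
Qed.

(** The sum is split according to whether a subset contains [e]. The exponents treat all cases at
    once: that of x - 1 is 1 exactly when [e] is an isthmus of the minor, that of y - 1 is 1 exactly
    when [e] is a loop, and otherwise they are 0. *)
Lemma tutte_minorU1 (R : comNzRingType) C S e (x y : R) : e \notin S ->
  tutte_minor M C (e |: S) x y =
    (x - 1) ^+ (rk (C :|: (e |: S)) - rk (C :|: S)) * tutte_minor M C S x y +
    (y - 1) ^+ (1 - (rk (e |: C) - rk C)) * tutte_minor M (e |: C) S x y.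
Proof.
move=> eNS; rewrite /tutte_minor big_subsetU1 // !mulr_sumr; congr (_ + _).
  apply: eq_bigr => A sA; rewrite mulrA -exprD.
  have := rank_subset M (setUS C sA).
  have := rank_subset M (setUS C (subsetUr [set e] S)).
  by move=> h1 h2; congr (_ ^+ _ * _); lia.
apply: eq_bigr => A sA; rewrite mulrCA -exprD !(setUCA C) !setUA.
congr (_ * _ ^+ _); have eNA : e \notin A by apply: contra eNS; apply: subsetP.
have := rankU_le M (e |: C) A; have := rank_subset M (subsetUl (e |: C) A).
have := rank_subset M (subsetUr [set e] C); have := rankU1_le M e C.
rewrite cardsU1 eNA; lia.
Qed.

(** Only rank differences enter the sum, and adjoining a loop or an isthmus shifts both terms of
    each difference by the same amount. *)
Lemma tutte_minor_loop_isthmus (R : comNzRingType) C S e (x y : R) :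
  rk (e |: C) = rk C \/ rk (C :|: (e |: S)) = (rk (C :|: S)).+1 ->
  tutte_minor M (e |: C) S x y = tutte_minor M C S x y.
Proof.
move=> he; suff rE A : A \subset S ->
    (rk (C :|: S) - rk (C :|: A) = rk (e |: (C :|: S)) - rk (e |: (C :|: A)))%N /\
    (rk (e |: (C :|: A)) - rk (e |: C) = rk (C :|: A) - rk C)%N.
  by apply: eq_bigr => A /rE[rS rA]; rewrite -!setUA rS rA.
move=> sA; case: he => [loop_e|].
  by rewrite loop_e !(rankU1_eq (subsetUl C _) loop_e).
rewrite setUCA => isth; have upr B : B \subset C :|: S -> rk (e |: B) = (rk B).+1.
  move=> sB; have := rankU1_le M e B; have := rank_subset M (subsetUr [set e] B).
  have [eqB|] := eqVneq (rk (e |: B)) (rk B); last lia.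
  by have := rankU1_eq sB eqB; lia.
by rewrite !upr ?subsetUl ?setUS //; lia.
Qed.

Lemma coloopless_contract C S e :
  e \notin S -> coloopless M C (e |: S) -> coloopless M (e |: C) S.
Proof.
move=> eNS /forall_inP cl; apply/forall_inP => x xS.
have xe : x != e by apply: contraNneq eNS => <-.
have := cl x; rewrite !inE xS orbT => /(_ isT).
have -> : (e |: S) :\ x = e |: (S :\ x).
  by apply/setP => z; rewrite !inE; case: (eqVneq z e) => // ->; rewrite eq_sym xe.
by rewrite !(setUCA C) !setUA.
Qed.

Lemma coloopless_delete_loop C S e :
  rk (e |: C) = rk C -> coloopless M C (e |: S) -> coloopless M C S.
Proof.
move=> loop_e /forall_inP cl; apply/forall_inP => x xS.
have le := rank_subset M (setUS C (subD1set S x)).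
have := cl x; rewrite inE xS orbT => /(_ isT).
rewrite setUCA (rankU1_eq (subsetUl C S) loop_e) eqn_leq => /andP[_ le2].
rewrite eqn_leq le /= (leq_trans le2) // -(rankU1_eq (subsetUl C (S :\ x)) loop_e).
apply: rank_subset; apply/subsetP => z; rewrite !inE.
by case: (z == x); case: (z == e); rewrite ?orbT ?orbF /= ?orbF.
Qed.

Lemma colooplessU1 C S e :
  e \notin S -> coloopless M C (e |: S) -> rk (C :|: (e |: S)) = rk (C :|: S).
Proof.
move=> eNS /forall_inP/(_ e); rewrite setU11 => /(_ isT) /eqP <-.
by rewrite setU1K.
Qed.

(** The value counts bases, each of which is a set of nonloops of size the rank. The induction is
    Pascal's rule: a nonloop [e] leaves the set of nonloops in both minors, and contracting it
    lowers the rank by one. *)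
Lemma tutte_minor_1_1_bounds C S :
  (0 <= tutte_minor M C S 1 1 :> int) /\
  tutte_minor M C S 1 1 <= ('C(#|nonloops M C S|, rk (C :|: S) - rk C))%:Z.
Proof.
move: C S; apply: minor_ind => [C|C S e eNS [p0 p1] [q0 q1]].
  by rewrite tutte_minor_set0 setU0 subnn bin0.
rewrite tutte_minorU1 // subrr !expr0n.
rewrite -(setUA _ C) in q1; rewrite (setUCA C [set e]); set N := nonloops M C (e |: S).
have geC := rank_subset M (subsetUr [set e] C); have leC := rankU1_le M e C.
have geS := rank_subset M (subsetUr [set e] (C :|: S)).
have leS := rankU1_le M e (C :|: S).
have geCS := rank_subset M (subsetUl C S).
have geCS' := rank_subset M (setUS [set e] (subsetUl C S)).
have sNC : nonloops M C S \subset N.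
  by apply/subsetP => x; rewrite !inE => /andP[-> ->]; rewrite orbT.
have lN := subset_leq_card sNC.
have [loop_e|nloop] := eqVneq (rk (e |: C)) (rk C).
  have eqS := rankU1_eq (subsetUl C S) loop_e.
  rewrite loop_e eqS !subnn eqxx !mul1r mul0r addr0.
  by split=> //; apply: le_trans p1 _; rewrite lez_nat leq_bin2l.
have eN : e \in N by rewrite !inE eqxx.
have sN' : nonloops M (e |: C) S \subset N :\ e.
  apply/subsetP => x; rewrite !inE => /andP[xS].
  have [->|xe] := eqVneq x e; first by rewrite setUA setUid eqxx.
  rewrite xS orbT /=; apply: contra_neq; apply: rankU1_eq; exact: subsetUr.
have := subset_leq_card sN'; rewrite [#|N|](cardsD1 e) eN add1n => lN'.
have eqC : rk (e |: C) = (rk C).+1 by lia.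
rewrite eqC subSnn subnn eqxx mul1r; rewrite eqC in q1.
have lesub : (rk (e |: (C :|: S)) - rk C = (rk (e |: (C :|: S)) - (rk C).+1).+1)%N by lia.
have sN'2 : nonloops M C S \subset N :\ e.
  apply/subsetP => x xN; rewrite in_setD1 (subsetP sNC) // andbT.
  by apply: contraNneq eNS => <-; move: xN; rewrite inE => /andP[].
have lN2 := subset_leq_card sN'2.
have b1 : ('C(#|nonloops M (e |: C) S|, rk (e |: (C :|: S)) - (rk C).+1) <=
   'C(#|N :\ e|, rk (e |: (C :|: S)) - (rk C).+1))%N by rewrite leq_bin2l.
rewrite lesub binS.
have [eqS|neS] := eqVneq (rk (e |: (C :|: S))) (rk (C :|: S)).
  have b2 : ('C(#|nonloops M C S|, rk (C :|: S) - rk C) <=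
   'C(#|N :\ e|, rk (e |: (C :|: S)) - rk C))%N by rewrite eqS leq_bin2l.
  by rewrite lesub in b2; rewrite eqS subnn eqxx mul1r -eqS PoszD;
    split; rewrite ?addr_ge0 ?lerD ?(le_trans p1) ?(le_trans q1) ?lez_nat.
have -> : (rk (e |: (C :|: S)) - rk (C :|: S) == 0)%N = false.
  by rewrite subn_eq0 leqNgt ltn_neqAle eq_sym neS geS.
by rewrite mul0r add0r PoszD; split; rewrite // ler_wpDl ?(le_trans q1) ?lez_nat.
Qed.

(** A loop gives coefficient -1 to the contraction, which cancels the equal deletion; any other
    element gives a sum of the two. *)
Lemma tutte_minor_2_0_ge0 C S : 0 <= tutte_minor M C S 2 0 :> int.
Proof.
move: C S; apply: minor_ind => [C|C S e eNS IHd IHc]; first by rewrite tutte_minor_set0.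
rewrite tutte_minorU1 //.
rewrite (_ : 2 - 1 = 1 :> int) // expr1n mul1r sub0r.
have [loop_e|nloop] := eqVneq (rk (e |: C)) (rk C).
  rewrite tutte_minor_loop_isthmus; last by left.
  by rewrite loop_e subnn expr1 mulN1r subrr.
have -> : (1 - (rk (e |: C) - rk C) = 0)%N.
  by have := rank_subset M (subsetUr [set e] C); lia.
by rewrite mul1r addr_ge0.
Qed.

(** For an isthmus, deletion and contraction agree and carry the coefficients -1 and 1. *)
Lemma tutte_minor_0_2_isthmus C S :
  ~~ coloopless M C S -> tutte_minor M C S 0 2 = 0 :> int.
Proof.
rewrite negb_forall_in => /exists_inP[e eS].
rewrite -{2 3}(setD1K eS); have : e \notin S :\ e by rewrite setD11.
move: (S :\ e) => {eS}S eNS ne; rewrite tutte_minorU1 //.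
have isth : rk (C :|: (e |: S)) = (rk (C :|: S)).+1.
  have := rankU1_le M e (C :|: S); have := rank_subset M (subsetUr [set e] (C :|: S)).
  by rewrite setUCA; move: ne; rewrite setUCA; lia.
rewrite tutte_minor_loop_isthmus; last by right.
by rewrite isth subSnn (_ : 2 - 1 = 1 :> int) // expr1n sub0r expr1 mulN1r mul1r addNr.
Qed.

Lemma tutte_minor_0_2U1 C S e : e \notin S -> coloopless M C (e |: S) ->
  tutte_minor M C (e |: S) 0 2 =
  tutte_minor M C S 0 2 + tutte_minor M (e |: C) S 0 2 :> int.
Proof.
move=> eNS cl; rewrite tutte_minorU1 // (colooplessU1 eNS cl) subnn.
by rewrite (_ : 2 - 1 = 1 :> int) // expr1n !mul1r.
Qed.

(** Removing a loop halves both sides. Contracting a nonloop preserves the exponent, and the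
    deletion term is nonnegative: it is 0 if an isthmus has appeared, and otherwise the induction
    applies. *)
Lemma tutte_minor_0_2_ge C S : coloopless M C S ->
  (2 ^ (#|S| - (rk (C :|: S) - rk C)))%N%:Z <= tutte_minor M C S 0 2 :> int.
Proof.
move: C S; apply: minor_ind => [C|C S e eNS IHd IHc cl].
  by rewrite tutte_minor_set0 cards0.
rewrite tutte_minor_0_2U1 // cardsU1 eNS.
have := IHc (coloopless_contract eNS cl); rewrite -(setUA _ C) (setUCA C [set e]).
have geC := rank_subset M (subsetUr [set e] C); have leC := rankU1_le M e C.
have geCS := rank_subset M (subsetUl C S).
have geCS' := rank_subset M (setUS [set e] (subsetUl C S)).
have eqS := colooplessU1 eNS cl; rewrite setUCA in eqS.
have leCS := rankU_le M C S.
have [loop_e|nloop] := eqVneq (rk (e |: C)) (rk C).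
  rewrite tutte_minor_loop_isthmus; last by left.
  rewrite loop_e eqS (_ : 1 + #|S| - (rk (C :|: S) - rk C) =
    (#|S| - (rk (C :|: S) - rk C)).+1)%N; last lia.
  by rewrite expnS; lia.
have -> : (1 + #|S| - (rk (e |: (C :|: S)) - rk C) =
  #|S| - (rk (e |: (C :|: S)) - rk (e |: C)))%N by lia.
suff : 0 <= tutte_minor M C S 0 2 :> int by lia.
have [cl'|/tutte_minor_0_2_isthmus -> //] := boolP (coloopless M C S).
by apply: le_trans (IHd cl').
Qed.

End DeletionContraction.

(** * The affine inequality with slack, used in small rank *)

Section AffineBound.
Variables (E : finType) (M : matroid E).
Implicit Types (A B C S : {set E}) (e x y : E).
Local Notation rk := (rank M).

(* Each nonloop x lies in a two-element cocircuit {x, y}.  For x outside a basis  *)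
(* B this forces y \in B, and x is determined by y, since otherwise {x, x'} would *)
(* contain a cocircuit missing B.                                                 *)
Lemma card_nonloops_le C S : coloopless M C S ->
    (forall e, e \in nonloops M C S -> ~~ coloopless M C (S :\ e)) ->
  (#|nonloops M C S| <= (rk (C :|: S) - rk C).*2)%N.
Proof.
move=> /forall_inP cl special; set N := nonloops M C S; set r := rk (C :|: S).
have {}cl x : x \in S -> rk (C :|: (S :\ x)) = r by move/cl/eqP.
have [B sBS [rB cB]] := rel_basis M C S.
have full A : B \subset A -> (r <= rk (C :|: A))%N.
  by move=> sBA; rewrite /r -rB rank_subset // setUS.
pose codep x y := (y \in S) && (rk (C :|: (S :\ x :\ y)) < r)%N.
pose partner x := odflt x [pick y | codep x y].
have partnerP x : x \in N -> codep x (partner x).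
  move=> xN; have xS : x \in S by case/setIdP: xN.
  rewrite /partner; case: pickP => //= nopick.
  have := special x xN; rewrite negb_forall_in => /exists_inP[y].
  rewrite inE => /andP[_ yS] ne; have := nopick y; rewrite /codep yS /=.
  by rewrite ltn_neqAle -(cl x xS) ne rank_subset // setUS // subD1set.
have partnerB x : x \in N :\: B -> partner x \in B.
  move=> /setDP[xN xNB]; have /andP[_] := partnerP x xN; apply: contraLR => yNB.
  by rewrite -leqNgt full // !subsetD1 sBS xNB.
have partner_inj : {in N :\: B &, injective partner}.
  move=> x x' /setDP[xN xNB] /setDP[x'N x'NB] eqp.
  have /andP[yS ltx] := partnerP x xN; have /andP[_ ltx'] := partnerP x' x'N.
  rewrite -eqp in ltx' ; set y := partner x in yS ltx ltx'.
  have xS : x \in S by case/setIdP: xN.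
  have x'S : x' \in S by case/setIdP: x'N.
  apply/eqP; apply: contraT => xx'.
  have xy : y != x.
    apply: contraTneq ltx => ->; rewrite (_ : _ :\ x :\ x = S :\ x) ?cl ?ltnn //.
    by apply/setP => z; rewrite !inE andbA andbb.
  have x'y : y != x'.
    apply: contraTneq ltx' => ->; rewrite (_ : _ :\ x' :\ x' = S :\ x') ?cl ?ltnn //.
    by apply/setP => z; rewrite !inE andbA andbb.
  (* The contradiction is a closure argument: [x'] will lie in the closure of [D], hence of
     [x |: D], whose rank is below [r]; yet adding [x'] to [x |: D] covers [S :\ y], which has rank
     [r]. *)
  set D := C :|: (S :\ x :\ x' :\ y).
  have eqDx : x |: D = C :|: (S :\ x' :\ y).
    apply/setP => z; rewrite !inE; have [->|] := eqVneq z x; last by [].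
    by rewrite xS xx' (eq_sym x y) xy orbT.
  have eqDx' : x' |: D = C :|: (S :\ x :\ y).
    apply/setP => z; rewrite !inE; have [->|_] := eqVneq z x'; last by rewrite andbCA.
    by rewrite x'S (eq_sym x' x) xx' (eq_sym x' y) x'y orbT.
  have eqDxx' : C :|: (S :\ y) \subset x' |: (x |: D).
    apply/subsetP => z; rewrite !inE.
    by case: (z == x); case: (z == x') => //=; rewrite ?orbT.
  have eqDy : C :|: (S :\ x :\ x') \subset y |: D.
    by apply/subsetP => z; rewrite !inE; case: (z == y); rewrite ?orbT.
  (* [D] has corank at most 1, since adding [y] to it covers [B]. *)
  have ler : (r <= (rk D).+1)%N.
    apply: leq_trans (rankU1_le M y D); apply: leq_trans (rank_subset M eqDy).
    by rewrite full // !subsetD1 sBS xNB x'NB.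
  have eqr : rk (x' |: D) = rk D.
    apply/eqP; rewrite eqn_leq (rank_subset M (subsetUr _ _)) andbT -ltnS.
    by rewrite eqDx' (leq_trans ltx ler).
  have := rank_subset M eqDxx'; rewrite cl // leqNgt.
  by rewrite (rankU1_eq (subsetUr [set x] D) eqr) eqDx ltx'.
have : (#|N :\: B| <= #|B|)%N.
  rewrite -(card_in_imset partner_inj); apply: subset_leq_card.
  by apply/subsetP => _ /imsetP[x xNB ->]; apply: partnerB.
have := subset_leq_card (subsetIr N B); rewrite -/r in cB.
by rewrite -[#|N|](cardsID B) -cB; lia.
Qed.

(* The value 0 for n = 0 < r is junk: there is no such matroid. *)
Fixpoint slack (n r : nat) : int :=
  match n, r with
  | _, 0 => (2 ^ n)%N%:Z - 2
  | 0, _.+1 => 0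
  | n'.+1, r'.+1 =>
    Num.min ((2 ^ (n - r))%N%:Z - (2 * 'C(minn n r.*2, r))%N%:Z)
            (slack n' r + slack n' r')
  end.

Lemma slack_le n r :
  slack n r.+1 <= (2 ^ (n - r.+1))%N%:Z - (2 * 'C(minn n r.+1.*2, r.+1))%N%:Z.
Proof. by case: n => [|n] /=; rewrite ?ge_min ?lexx // min0n. Qed.

(** The branches of [slack] match the cases. In rank 0 there is at most one basis. If deleting some
    nonloop leaves no isthmus, the inequality for deletion and contraction adds up. Otherwise
    [card_nonloops_le] improves the binomial bound, and the direct power-of-2 bound is used. *)
Lemma tutte_minor_0_2_affine C S : coloopless M C S ->
  2 * tutte_minor M C S 1 1 + slack #|S| (rk (C :|: S) - rk C)
    <= tutte_minor M C S 0 2.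
Proof.
have [k] := ubnP #|S|; elim: k C S => // k IHk C S ltk cl.
have [_ le11] := tutte_minor_1_1_bounds M C S.
have ge02 := tutte_minor_0_2_ge cl.
case def_r: (rk (C :|: S) - rk C)%N le11 ge02 => [|r] le11 ge02.
  rewrite bin0 subn0 in le11 ge02.
  have -> : slack #|S| 0 = (2 ^ #|S|)%N%:Z - 2 by case: #|S|.
  move: le11 ge02; move: (tutte_minor _ _ _ 1 1) (tutte_minor _ _ _ 0 2) (2 ^ _)%N.
  by move=> a b c; lia.
have [/exists_inP[e eN cle]|special] :=
  boolP [exists e in nonloops M C S, coloopless M C (S :\ e)]; last first.
  have kS : (#|nonloops M C S| <= #|S|)%N.
    by apply: subset_leq_card; apply/subsetP => x /setIdP[].
  have k2r : (#|nonloops M C S| <= r.+1.*2)%N.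
    rewrite -def_r; apply: card_nonloops_le => // e eN.
    by apply: contra special => cle; apply/exists_inP; exists e.
  have := slack_le #|S| r.
  have : ('C(#|nonloops M C S|, r.+1) <= 'C(minn #|S| r.+1.*2, r.+1))%N.
    by rewrite leq_bin2l // leq_min kS.
  move: le11 ge02; move: (tutte_minor _ _ _ 1 1) (tutte_minor _ _ _ 0 2) => a b.
  by move: (slack _ _) (2 ^ _)%N 'C(_, _) 'C(_, _) => s p c d; lia.
case/setIdP: eN => eS nloop; rewrite -(setD1K eS) in cl def_r ltk *.
have eNS : e \notin S :\ e by rewrite setD11.
move: (S :\ e) eNS cle cl def_r ltk => {le11 ge02 eS}S eNS cle cl def_r ltk.
have eqS := colooplessU1 eNS cl; rewrite cardsU1 eNS /= in ltk *.
have geC := rank_subset M (subsetUr [set e] C); have leC := rankU1_le M e C.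
have eqC : rk (e |: C) = (rk C).+1 by move: nloop; lia.
have := IHk C S ltk cle; have := IHk (e |: C) S ltk (coloopless_contract eNS cl).
rewrite -eqS def_r -setUA setUCA eqC (_ : _ - _.+1 = r)%N; last lia.
rewrite tutte_minor_0_2U1 // tutte_minorU1 // eqS eqC subSnn !subnn !mul1r.
have : slack #|S|.+1 r.+1 <= slack #|S| r.+1 + slack #|S| r.
  by rewrite /= ge_min lexx orbT.
move: (slack _ _) (slack _ _) (slack _ _) => s0 s1 s2.
move: (tutte_minor _ _ _ 1 1) (tutte_minor _ _ _ 1 1) => a0 a1.
by move: (tutte_minor _ _ _ 0 2) (tutte_minor _ _ _ 0 2) => b0 b1; lia.
Qed.
End AffineBound.

(** * Numerical estimates: the slack and the binomial coefficient *)

(** The diagonal n = 3r is computed for r from 1 to 7. Beyond it, the recursive branch is a sum of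
    nonnegative terms, while in the other branch the binomial coefficient stays at C(2r,r) and the
    power of 2 grows with n. *)
Lemma slack_ge0 n r : (0 < n)%N -> (3 * r <= n)%N -> (r <= 7)%N -> 0 <= slack n r.
Proof.
have base i : (i < 7)%N -> 0 <= slack (3 * i.+1) i.+1.
  move=> lti; have /allP/(_ i) : all (fun j => 0 <= slack (3 * j.+1) j.+1) (iota 0 7).
    by vm_compute.
  by apply; rewrite mem_iota.
elim: n r => // n IHn [|r] _ le3 le7.
  by have := expn_gt0 2 n; rewrite /= expnS; lia.
have [<-|ne3] := eqVneq (3 * r.+1)%N n.+1; first exact: base.
have [n_gt0 n3r n3r' r7] : [/\ 0 < n, 3 * r.+1 <= n, 3 * r <= n & r <= 7]%N by split; lia.
rewrite /= le_min; apply/andP; split; last by rewrite addr_ge0 ?IHn.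
have := le_trans (base r le7) (slack_le _ _); rewrite !subr_ge0 !lez_nat.
rewrite (_ : minn (3 * r.+1) _ = r.+1.*2); last lia.
rewrite (_ : minn n.+1 _ = r.+1.*2); last lia.
by move=> le_base; apply: leq_trans le_base _; rewrite leq_pexp2l //; lia.
Qed.

(* The term j = r of the binomial expansion of (4 + 1)^n. *)
Lemma bin_expn_le n r : (r <= n)%N -> ('C(n, r) * 4 ^ (n - r) <= 5 ^ n)%N.
Proof.
move=> lern; rewrite -[5%N]/(4 + 1)%N expnDn.
rewrite (bigD1 (inord r)) //= inordK ?ltnS // exp1n muln1; exact: leq_addr.
Qed.

(** After multiplication by 4^(n-r), [bin_expn_le] reduces the claim to 2 * 5^n <= 8^(n-r). The
    weight 4 is the ratio (n-r)/r at the extreme case n = 5r. *)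
Lemma double_bin_le n r :
  (3 <= r)%N -> (5 * r <= n)%N -> (2 * 'C(n, r) <= 2 ^ (n - r))%N.
Proof.
move=> r3 /subnKC <-; set k := (n - 5 * r)%N; set m := (5 * r + k)%N.
have lerm : (r <= m)%N by lia.
have pos4 : (0 < 4 ^ (m - r))%N by rewrite expn_gt0.
rewrite -(leq_pmul2r pos4) -mulnA -expnMn.
apply: leq_trans (_ : 2 * 5 ^ m <= _)%N; first by rewrite leq_mul2l bin_expn_le.
rewrite (_ : m - r = 4 * r + k)%N; last lia.
have lepow a b j : (a <= b)%N -> (a ^ j <= b ^ j)%N.
  by case: j => // j leab; rewrite leq_exp2r.
rewrite (expnD 5 (5 * r)) (expnD _ (4 * r)) mulnA leq_mul ?lepow //.
(* What remains is 2 * 5^(5r) <= 8^(4r). Cubing brings in 5^3 = 125 <= 128 = 2^7, and the exponents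
   then need 3 + 35r <= 36r, that is, r >= 3. *)
rewrite -(leq_exp2r _ _ (isT : 0 < 3)%N) expnMn -!expnM.
rewrite (_ : 5 * r * 3 = 3 * (5 * r))%N; last lia.
rewrite (expnM 5 3) (_ : 2 * 4 = 2 ^ 3)%N // -(expnM 2 3).
apply: leq_trans (_ : 2 ^ 3 * 2 ^ (7 * (5 * r)) <= _)%N.
  by apply: leq_mul => //; rewrite (expnM 2 7); apply: lepow.
by rewrite -expnD leq_exp2l //; lia.
Qed.

(** * Lower bounds for iterated logarithms *)

Section Log2.
Variable R : realType.
Implicit Types x : R.

Lemma log2_ge (p q : nat) x : (0 < q)%N -> 0 < x -> 2 ^+ p <= x ^+ q ->
  p%:R / q%:R <= log2 x.
Proof.
move=> q0 x0 le2; have ln2 : 0 < ln 2 :> R by rewrite ln_gt0 // ltr1n.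
rewrite /log2 ler_pdivlMr // mulrAC ler_pdivrMr ?ltr0n // !mulr_natl mulr_natr.
by rewrite -!lnXn ?ler_ln ?posrE ?exprn_gt0.
Qed.

Lemma sum_log2_ge3 x : 4 <= x -> 3 <= log2 x + log2 (log2 x) + log2 (log2 (log2 x)).
Proof.
move=> x4.
have l1 : 2%:R / 1%:R <= log2 x by apply: log2_ge => //; [lra|rewrite expr1; lra].
have l2 : 1%:R / 1%:R <= log2 (log2 x) by apply: log2_ge => //; lra.
have l3 : 0%:R / 1%:R <= log2 (log2 (log2 x)) by apply: log2_ge => //; lra.
lra.
Qed.

(** The bound is 3 + 3/2 + 1/2, from 2^3 <= 8, 2^3 <= 3^2 and 2 <= (3/2)^2. *)
Lemma sum_log2_ge5 x : 8 <= x -> 5 <= log2 x + log2 (log2 x) + log2 (log2 (log2 x)).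
Proof.
move=> x8.
have l1 : 3%:R / 1%:R <= log2 x by apply: log2_ge => //; [lra|rewrite expr1; lra].
have l2 : 3%:R / 2%:R <= log2 (log2 x) by apply: log2_ge => //; [lra|nra].
have l3 : 1%:R / 2%:R <= log2 (log2 (log2 x)) by apply: log2_ge => //; [lra|nra].
lra.
Qed.

End Log2.

(** * Passage to the whole matroid and the two ranges of rank *)

Lemma isthmus_rank (E : finType) (M : matroid E) (e : E) :
  rank M [set~ e] != rank M [set: E] -> isthmus M e.
Proof.
move=> ne B /maxsetP[iB maxB]; apply: contraNT ne => eNB.
have [J [iJ sBJ _ cJ]] := indep_extend iB (subsetT B).
rewrite eqn_leq rank_subset ?subsetT //= -cJ (maxB J iJ sBJ) rank_indep //.
by rewrite subsetC sub1set inE.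
Qed.

Lemma tutte_minorT (R : comNzRingType) (E : finType) (M : matroid E) (x y : R) :
  tutte_minor M set0 [set: E] x y = tutte M x y.
Proof. by apply: eq_big => A; rewrite ?subsetT // !set0U rank_set0 subn0. Qed.

Theorem theorem2p1 (R : realType) (E : finType) (M : matroid E) (n r : nat)
    (no_isthmus : forall e : E, ~ isthmus M e)
    (card_n : #|E| = n) (rank_r : rank M [set: E] = r)
    (r_ge4 : (4 <= r)%N)
    (n_ge : Num.ceil (r%:R * (log2 r%:R + log2 (log2 r%:R)
                              + log2 (log2 (log2 r%:R))) : R) <= n%:Z) :
  2 * tutte M 1 1 <= tutte M 0 2 :> int
  /\ 2 * tutte M 1 1 <= tutte M 2 0 + tutte M 0 2 :> int.
Proof.
suff main : 2 * tutte M 1 1 <= tutte M 0 2 :> int.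
  split=> //; have := tutte_minor_2_0_ge0 M set0 [set: E]; rewrite tutte_minorT.
  by move=> ge0; rewrite ler_wpDl.
have cl : coloopless M set0 [set: E].
  apply/forall_inP => e _; rewrite !set0U setTD; apply/negP => /negP ne.
  by case: (no_isthmus e); apply: isthmus_rank.
have n_geR (c : nat) : c%:R <= (log2 r%:R + log2 (log2 r%:R)
    + log2 (log2 (log2 r%:R)) : R) -> (c * r <= n)%N.
  move=> le_c; rewrite -(ler_nat R) natrM mulrC.
  rewrite ceil_le_int in n_ge; apply: le_trans n_ge.
  by rewrite ler_wpM2l.
have rT : (rank M (set0 :|: [set: E]) - rank M set0 = r)%N by rewrite set0U rank_set0 subn0.
have [r_le7|r_ge8] := leqP r 7.
  have n3r : (3 * r <= n)%N by apply/n_geR/sum_log2_ge3; rewrite ler_nat.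
  have := tutte_minor_0_2_affine cl; rewrite rT !tutte_minorT cardsT card_n.
  by apply: le_trans; rewrite lerDl slack_ge0 //; lia.
have n5r : (5 * r <= n)%N by apply/n_geR/sum_log2_ge5; rewrite ler_nat.
have [_] := tutte_minor_1_1_bounds M set0 [set: E].
have := tutte_minor_0_2_ge cl; rewrite rT !tutte_minorT cardsT card_n.
have le_k : (#|nonloops M set0 [set: E]| <= n)%N by rewrite -card_n max_card.
have := leq_bin2l r le_k; have := double_bin_le (leq_trans (isT : 3 <= 8)%N r_ge8) n5r.
move: (tutte M 1 1) (tutte M 0 2) => a b.
by move: (2 ^ _)%N 'C(_, _) 'C(_, _) => p c d; lia.
Qed.
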